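(* Let $J,n\ge 1$ be integers, let $Y$ be a real $J\times n$ matrix, let $p,\underline x,\overline x\in\mathbb{R}^n$, let $r\in\mathbb{R}^J$ have non-positive components, let $R\in\mathbb{R}$, and let $\delta\ge 0$. Assume that the original linear problem $$\text{maximize } p^{\mathrm T}x \text{ subject to } \underline x\le x\le\overline x \text{ and } r^{\mathrm T}P_\pi Yx\le R \text{ for every } \pi\in S_J$$ has a solution. Suppose that the cutting-plane algorithm (described in the context) with target risk $R$ and risk error tolerance $\delta$ terminates with solution $x^*$, achieved risk $R^*=\mu_r(Yx^* )$ and obtained profit $s=p^{\mathrm T}x^*$. Then there is a number $R'$ with $$R\le R'\le R^*$$ such that $f(R')=s$, where $f$ is the efficient frontier. In other words, there is a frontier point (a point of the graph of $f$) between the points $(R,s)$ and $(R^*,s)$.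
   Context: Vector inequalities are read component by component. $S_J$ is the set of all permutations of $\{1,\dots,J\}$ and $P_\pi$ is the $J\times J$ permutation matrix associated with $\pi\in S_J$. For $y\in\mathbb{R}^J$, the risk metric is $$\mu_r(y)=\max_{\pi\in S_J} r^{\mathrm T}P_\pi y.$$ Efficient frontier: let $D$ be the set of all $R'\in\mathbb{R}$ for which $\{x'\in\mathbb{R}^n:\underline x\le x'\le\overline x,\ \mu_r(Yx')\le R'\}$ is non-empty. Define $f:D\to\mathbb{R}$ by $$f(R')=\max\{p^{\mathrm T}x' : \underline x\le x'\le\overline x,\ \mu_r(Yx')\le R'\}.$$ Cutting-plane algorithm, with inputs $Y,p,\overline x,\underline x,r,R,\delta$: 1. Initialize the constraint set $C$ to consist of the constraints $\underline x\le x\le\overline x$. 2. Maximize $p^{\mathrm T}x$ subject to the constraints in $C$; denote the solution by $x^*$. 3. Set $R^*=\mu_r(Yx^* )$. If $|R^*-R|\le\delta R$, terminate with output $x^*$, $R^*$ and $s=p^{\mathrm T}x^*$. 4. Otherwise let $\pi\in S_J$ be a permutation such that the components of $P_\pi Yx^*$ are in increasing order, and add the constraint $r^{\mathrm T}P_\pi Yx\le R$ to $C$. 5. Return to step 2.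
   Formalization: The displayed range R ≤ R' ≤ R* is replaced by ''R' lies between R and R*'' (R ≤ R' ≤ R* or R* ≤ R' ≤ R), since the algorithm can stop with R* < R, where the displayed chain is impossible; for R ≤ R* the two agree. *)

(* Defs.v *)
From HB Require Import structures.
From mathcomp Require Import all_boot all_order all_algebra all_fingroup.
From mathcomp Require Import classical_sets reals.
Set Implicit Arguments.
Unset Strict Implicit.
Unset Printing Implicit Defensive.
Import Order.TTheory GRing.Theory Num.Theory.
Local Open Scope classical_set_scope.
Local Open Scope ring_scope.

Definition vle (K : realType) (m : nat) (u v : 'cV[K]_m) : Prop :=
  forall i, u i 0 <= v i 0.

Definition dotp (K : realType) (m : nat) (u v : 'cV[K]_m) : K :=
  (u^T *m v) 0 0.

(* perm_mx w is the matrix with entries (w i == j), so that component i of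
   perm_mx w *m y is y (w i). *)
Definition perm_risk (K : realType) (J : nat) (r : 'cV[K]_J) (w : 'S_J)
  (y : 'cV[K]_J) : K := dotp r (perm_mx w *m y).

(* The identity permutation only supplies the base value of the iterated
   maximum; that value is itself one of the terms. *)
Definition risk (K : realType) (J : nat) (r y : 'cV[K]_J) : K :=
  \big[Num.max/perm_risk r 1%g y]_(w : 'S_J) perm_risk r w y.

Definition box (K : realType) (n : nat) (xlo xhi : 'cV[K]_n) : set 'cV[K]_n :=
  [set x | vle xlo x /\ vle x xhi].

Definition is_max (K : realType) (A : set K) (m : K) : Prop :=
  A m /\ ubound A m.

Definition maximizes (K : realType) (n : nat) (p : 'cV[K]_n)
  (F : set 'cV[K]_n) (x : 'cV[K]_n) : Prop :=
  F x /\ forall x', F x' -> dotp p x' <= dotp p x.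

(* The box together with the cuts indexed by the permutations in C. *)
Definition cut_feasible (K : realType) (J n : nat) (Y : 'M[K]_(J, n))
  (xlo xhi : 'cV[K]_n) (r : 'cV[K]_J) (R : K) (C : {set 'S_J}) :
  set 'cV[K]_n :=
  [set x | box xlo xhi x /\
           forall w : 'S_J, w \in C -> perm_risk r w (Y *m x) <= R].

Definition original_feasible (K : realType) (J n : nat) (Y : 'M[K]_(J, n))
  (xlo xhi : 'cV[K]_n) (r : 'cV[K]_J) (R : K) : set 'cV[K]_n :=
  [set x | box xlo xhi x /\
           forall w : 'S_J, perm_risk r w (Y *m x) <= R].

Definition frontier_feasible (K : realType) (J n : nat) (Y : 'M[K]_(J, n))
  (xlo xhi : 'cV[K]_n) (r : 'cV[K]_J) (R' : K) : set 'cV[K]_n :=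
  [set x | box xlo xhi x /\ risk r (Y *m x) <= R'].

Definition frontier_dom (K : realType) (J n : nat) (Y : 'M[K]_(J, n))
  (xlo xhi : 'cV[K]_n) (r : 'cV[K]_J) : set K :=
  [set R' | frontier_feasible Y xlo xhi r R' !=set0].

(* The graph of the efficient frontier f : R' lies in the domain of f, the
   maximum defining f R' is attained, and its value is v. *)
Definition frontier_graph (K : realType) (J n : nat) (Y : 'M[K]_(J, n))
  (p xlo xhi : 'cV[K]_n) (r : 'cV[K]_J) (R' v : K) : Prop :=
  frontier_dom Y xlo xhi r R' /\
  is_max (dotp p @` frontier_feasible Y xlo xhi r R') v.

(* Ties are allowed: increasing is read as nondecreasing, since a permutation
   sorting y strictly need not exist. *)
Definition sorts (K : realType) (J : nat) (w : 'S_J) (y : 'cV[K]_J) : Prop :=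
  forall i j : 'I_J, (i <= j)%N ->
    (perm_mx w *m y) i 0 <= (perm_mx w *m y) j 0.

Definition stop_test (K : realType) (R delta Rs : K) : Prop :=
  `|Rs - R| <= delta * R.

(* The cut sets C with which step 2 of the algorithm can be entered; the box
   constraints are always present.  Neither the maximizer nor the sorting
   permutation need be unique, and any choice is allowed. *)
Inductive reachable (K : realType) (J n : nat) (Y : 'M[K]_(J, n))
  (p xlo xhi : 'cV[K]_n) (r : 'cV[K]_J) (R delta : K) : {set 'S_J} -> Prop :=
| reachable_init : reachable Y p xlo xhi r R delta finset.set0
| reachable_cut (C : {set 'S_J}) (x : 'cV[K]_n) (w : 'S_J) :
    reachable Y p xlo xhi r R delta C ->
    maximizes p (cut_feasible Y xlo xhi r R C) x ->
    ~ stop_test R delta (risk r (Y *m x)) ->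
    sorts w (Y *m x) ->
    reachable Y p xlo xhi r R delta (w |: C)%SET.

Definition terminates_with (K : realType) (J n : nat) (Y : 'M[K]_(J, n))
  (p xlo xhi : 'cV[K]_n) (r : 'cV[K]_J) (R delta : K)
  (xs : 'cV[K]_n) (Rs s : K) : Prop :=
  exists C : {set 'S_J},
    [/\ reachable Y p xlo xhi r R delta C,
        maximizes p (cut_feasible Y xlo xhi r R C) xs,
        Rs = risk r (Y *m xs),
        stop_test R delta Rs
      & s = dotp p xs].

(* Main.v *)
Require Import Defs.
From HB Require Import structures.
From mathcomp Require Import all_boot all_order all_algebra all_fingroup.
From mathcomp Require Import lra.
From mathcomp Require Import classical_sets reals topology normedtype derive.
Set Implicit Arguments.
Unset Strict Implicit.
Unset Printing Implicit Defensive.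
Import Order.TTheory GRing.Theory Num.Theory.
Import numFieldNormedType.Exports.
Local Open Scope ring_scope.

(** Every cut is implied by the original problem, so the final iterate [xs]
    maximizes the profit over a set containing the original feasible set.
    If [Rs <= R], then [xs] is itself feasible and [R' = Rs] works.
    If [R < Rs], let [x0] solve the original problem, so that its profit is at
    most [s].  When it equals [s], [R' = R] works.  When it is smaller, take for
    [R'] the minimal risk, over the box, of a point with profit at least [s];
    a point of risk at most [R'] with profit above [s] could be moved towards
    [x0] until its profit is [s], which by convexity of the risk would push the
    risk strictly below the minimum [R']. *)

Lemma dotpDr (K : realType) (m : nat) (a u v : 'cV[K]_m) :
  dotp a (u + v) = dotp a u + dotp a v.
Proof. by rewrite /dotp mulmxDr mxE. Qed.

Lemma dotpZr (K : realType) (m : nat) (a u : 'cV[K]_m) (t : K) :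
  dotp a (t *: u) = t * dotp a u.
Proof. by rewrite /dotp -scalemxAr mxE. Qed.

Lemma risk_leP (K : realType) (J : nat) (r y : 'cV[K]_J) (R : K) :
  reflect (forall w : 'S_J, perm_risk r w y <= R) (risk r y <= R).
Proof.
apply: (iffP (bigmax_leP _ _ _ _)) => [[_ h] w|h]; first exact: h.
by split=> [|w _]; exact: h.
Qed.

(** Each [perm_risk r w] is linear in the vector and bounded by [risk]; a maximum of linear forms is
    convex. *)
Lemma risk_convex (K : realType) (J : nat) (r u v : 'cV[K]_J) (t : K) :
  0 <= t <= 1 ->
  risk r (t *: u + (1 - t) *: v) <= t * risk r u + (1 - t) * risk r v.
Proof.
move=> /andP[t0 t1]; apply/risk_leP => w.
rewrite /perm_risk mulmxDr -!scalemxAr dotpDr !dotpZr.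
have le_risk y : perm_risk r w y <= risk r y
  by exact: (elimT (risk_leP r y _) (lexx _)).
by apply: lerD; apply: ler_wpM2l; rewrite ?subr_ge0 //; exact: le_risk.
Qed.

Lemma box_convex (K : realType) (n : nat) (xlo xhi u v : 'cV[K]_n) (t : K) :
  0 <= t <= 1 -> box xlo xhi u -> box xlo xhi v ->
  box xlo xhi (t *: u + (1 - t) *: v).
Proof.
move=> /andP[t0 t1] [lu uh] [lv vh].
split=> i; rewrite !mxE; first by move: (lu i) (lv i); nra.
by move: (uh i) (vh i); nra.
Qed.

(** The variable is a row because [rV_compact] and [EVT_min_rV], used below, concern row vectors. *)
Lemma continuous_dotp_mulmx (K : realType) (m n : nat) (a : 'cV[K]_m)
  (M : 'M[K]_(m, n)) : continuous (fun v : 'rV[K]_n => dotp a (M *m v^T)).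
Proof.
have -> : (fun v : 'rV[K]_n => dotp a (M *m v^T)) =
    (fun v => \sum_(j < n) (a^T *m M) 0 j * v 0 j).
  apply/boolp.funext => v; rewrite /dotp mulmxA mxE.
  by apply: eq_bigr => j _; rewrite [v^T _ _]mxE.
apply: continuous_big => [|j _ v]; first exact: add_continuous.
by apply: continuousM; [exact: cst_continuous | exact: coord_continuous].
Qed.

Lemma continuous_risk_mulmx (K : realType) (J n : nat) (r : 'cV[K]_J)
  (Y : 'M[K]_(J, n)) : continuous (fun v : 'rV[K]_n => risk r (Y *m v^T)).
Proof.
have cont w : continuous (fun v : 'rV[K]_n => perm_risk r w (Y *m v^T)).
  have -> : (fun v : 'rV[K]_n => perm_risk r w (Y *m v^T)) =
      (fun v => dotp r ((perm_mx w *m Y) *m v^T)).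
    by apply/boolp.funext => v; rewrite /perm_risk mulmxA.
  exact: continuous_dotp_mulmx.
(* Induction on the list under the maximum; the base value, at the identity permutation, is itself
   continuous. *)
rewrite /risk; elim: (index_enum _) => [|w e IHe].
  under boolp.eq_fun do rewrite big_nil.
  exact: cont.
under boolp.eq_fun do rewrite big_cons.
move=> v; exact: (continuous_max (cont w v) (IHe v)).
Qed.

(** The box is compact and the half-space of profit at least [s] is closed, so the extreme value
    theorem applies to their intersection, which contains [x]. *)
Lemma min_risk_attained (K : realType) (J n : nat) (Y : 'M[K]_(J, n))
  (p xlo xhi : 'cV[K]_n) (r : 'cV[K]_J) (s : K) (x : 'cV[K]_n) :
  box xlo xhi x -> s <= dotp p x ->
  exists y, [/\ box xlo xhi y, s <= dotp p y &
    forall z, box xlo xhi z -> s <= dotp p z ->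
      risk r (Y *m y) <= risk r (Y *m z)].
Proof.
move=> bx sx.
pose B := [set v : 'rV[K]_n | forall i, `[xlo i 0, xhi i 0]%classic (v ord0 i)]%classic.
pose H := [set v : 'rV[K]_n | s <= dotp p v^T]%classic.
have boxP v : B v <-> box xlo xhi v^T.
  split=> [Bv|[lv vh] i] /=.
    by split=> i; move: (Bv i) => /=; rewrite in_itv /= mxE => /andP[].
  by move: (lv i) (vh i); rewrite in_itv /= !mxE => -> ->.
have cB : compact B.
  exact: (rV_compact (fun i => @segment_compact K (xlo i 0) (xhi i 0))).
have cH : closed H.
  have c : continuous (fun v : 'rV[K]_n => dotp p v^T).
    under boolp.eq_fun do rewrite -[_^T]mul1mx.
    exact: continuous_dotp_mulmx.
  exact: (continuous_closedP _).1 c _ (@closed_ge K s).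
have BHx : (B `&` H)%classic x^T by split; [apply/boxP|rewrite /H /=]; rewrite trmxK.
have [||v] := @EVT_min_rV K n (fun v => risk r (Y *m v^T)) (B `&` H)%classic _
  (compact_closedI cB cH).
- by exists x^T.
- exact/continuous_subspaceT/continuous_risk_mulmx.
rewrite inE => -[/boxP Bv Hv] vmin; exists v^T; split=> // z bz sz.
rewrite -[z]trmxK; apply: vmin; rewrite inE; split; first by apply/boxP; rewrite trmxK.
by rewrite /H /= trmxK.
Qed.

Theorem mainTheorem1 (K : realType) (J n : nat) (hJ : (1 <= J)%N)
  (hn : (1 <= n)%N) (Y : 'M[K]_(J, n)) (p xlo xhi : 'cV[K]_n)
  (r : 'cV[K]_J) (hr : vle r 0) (R delta : K) (hdelta : 0 <= delta)
  (hsol : exists x0 : 'cV[K]_n,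
     maximizes p (original_feasible Y xlo xhi r R) x0)
  (xs : 'cV[K]_n) (Rs s : K)
  (hterm : terminates_with Y p xlo xhi r R delta xs Rs s) :
  exists R' : K,
    (R <= R' <= Rs \/ Rs <= R' <= R) /\ frontier_graph Y p xlo xhi r R' s.
Proof.
have [C [_ [[bxs _] xsmax] RsE _ sE]] := hterm.
have [x0 [[bx0 cx0] x0max]] := hsol.
have riskx0 : risk r (Y *m x0) <= R by exact/risk_leP.
have frontier R' y : box xlo xhi y -> risk r (Y *m y) <= R' -> dotp p y = s ->
    (forall z, box xlo xhi z -> risk r (Y *m z) <= R' -> dotp p z <= s) ->
    frontier_graph Y p xlo xhi r R' s.
  move=> yb yR ys ymax; split; first by exists y.
  split; first by exists y.
  by move=> _ [z [bz zR] <-]; exact: ymax.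
have [leRs|ltRs] := leP Rs R.
  exists Rs; split; first by right; rewrite lexx.
  apply: (frontier _ xs) => [||//|z bz zR]; rewrite ?RsE //.
  rewrite sE; apply: xsmax; split=> // w _.
  by apply/risk_leP: w; exact: le_trans leRs.
have : dotp p x0 <= s by rewrite sE; apply: xsmax.
rewrite le_eqVlt => /orP[/eqP x0s|x0s].
  exists R; split; first by left; rewrite lexx ltW.
  apply: (frontier _ x0) => // z bz zR.
  by rewrite -x0s; apply: x0max; split=> //; exact/risk_leP.
have sxs : s <= dotp p xs by rewrite sE.
have [y [yb ys ymin]] := min_risk_attained Y r bxs sxs.
(* Otherwise [y] would be feasible for the original problem with profit above the optimum at
   [x0]. *)
have ltR : R < risk r (Y *m y).
  rewrite ltNge; apply/negP => /risk_leP yR.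
  by have := x0max _ (conj yb yR); rewrite leNgt (lt_le_trans x0s ys).
have profit_le z : box xlo xhi z -> risk r (Y *m z) <= risk r (Y *m y) ->
    dotp p z <= s.
  move=> bz zR; rewrite leNgt; apply/negP => sz.
  (* Profit is affine on the segment from [x0] to [z]; it equals [s] at parameter [t]. *)
  pose t := (s - dotp p x0) / (dotp p z - dotp p x0).
  have d0 : 0 < dotp p z - dotp p x0 by rewrite subr_gt0 (lt_trans x0s).
  have t0 : 0 <= t by rewrite divr_ge0 ?ltW // subr_gt0.
  have t1 : t < 1 by rewrite ltr_pdivrMr // mul1r ltrD2r.
  have t01 : 0 <= t <= 1 by rewrite t0 ltW.
  have profit_s : dotp p (t *: z + (1 - t) *: x0) = s.
    rewrite dotpDr !dotpZr.
    have : t * (dotp p z - dotp p x0) = s - dotp p x0 by rewrite divfK ?gt_eqF.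
    lra.
  (* With [m] the minimal risk, convexity bounds the risk of this point by [t * m + (1 - t) * R],
     which is below [m] since [t < 1] and [R < m]. *)
  have := ymin _ (box_convex t01 bz bx0); rewrite profit_s lexx => /(_ isT).
  rewrite mulmxDr -!scalemxAr => /le_trans/(_ (risk_convex _ _ _ t01)).
  nra.
exists (risk r (Y *m y)); split.
  (* The upper bound holds because [xs] competes in the minimization. *)
  by left; rewrite ltW //= RsE; exact: ymin.
(* Applied to [y] itself, [profit_le] makes its profit exactly [s]. *)
apply: (frontier _ y) => //; apply: le_anti; rewrite ys andbT.
exact: profit_le.
Qed.
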